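(* Let $\omega,\omega'$ be two free ultrafilters on $\mathbb N$ and let $R$ be the hyperfinite type $II_1$ factor. Then $$(R^{\omega})^{\omega'}\cong R^{\omega\otimes\omega'}.$$
   Context: For ultrafilters $\mathcal U$ on $I$ and $\mathcal V$ on $J$, the tensor product $\mathcal U\otimes\mathcal V$ is the ultrafilter on $I\times J$ defined by $X\in\mathcal U\otimes\mathcal V\iff\{i\in I:\{j\in J:(i,j)\in X\}\in\mathcal V\}\in\mathcal U$. For a von Neumann algebra $M$ with faithful normal tracial state $\mathrm{tr}$ and an ultrafilter $\mathcal W$ on a set $K$, the (tracial) ultrapower is $M^{\mathcal W}=\ell^\infty(K,M)/\{(x_k)_k:\lim_{k\to\mathcal W}\mathrm{tr}(x_k^*x_k)=0\}$, with trace $\tau((x_k)_k)=\lim_{k\to\mathcal W}\mathrm{tr}(x_k)$. Here $(R^\omega)^{\omega'}$ is the ultrapower along $\omega'$ of the tracial von Neumann algebra $R^\omega$, and $R^{\omega\otimes\omega'}$ is the ultrapower of $R$ along the ultrafilter $\omega\otimes\omega'$ on $\mathbb N\times\mathbb N$.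
   Formalization: The order of the tensor factors is corrected: with the given definition of the tensor product, the isomorphism proved is (R^ω)^{ω'} ≅ R^{ω'⊗ω}; the printed R^{ω⊗ω'} would assert that the two ultrapowers commute, which can fail without CH. *)

(* Defs.v *)
From HB Require Import structures.
From mathcomp Require Import all_boot all_order all_algebra.
From mathcomp Require Import generic_quotient ring_quotient sesquilinear.
From mathcomp Require Import complex.
From mathcomp Require Import all_classical all_reals topology normedtype.
From mathcomp Require Import ring lra.

Set Implicit Arguments.
Unset Strict Implicit.
Unset Printing Implicit Defensive.

Import Order.TTheory GRing.Theory Num.Theory.
Import numFieldNormedType.Exports.

Local Open Scope classical_set_scope.
Local Open Scope complex_scope.
Local Open Scope ring_scope.
Local Open Scope quotient_scope.

Notation normc := ComplexField.Normc.normc.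

(* Unital *-algebras over the complex numbers F[i]. *)
Record starAlg (F : realType) := StarAlg {
  sa_alg :> algType F[i];
  star : sa_alg -> sa_alg;
  starD : {morph star : x y / x + y};
  starZ : forall (c : F[i]) (x : sa_alg), star (c *: x) = c^* *: star x;
  starM : forall x y : sa_alg, star (x * y) = star y * star x;
  starK : involutive star }.

(* The part of the structure of a von Neumann algebra with a faithful normal
   tracial state that enters the ultrapower construction: operator norm and
   trace.  Both tracial von Neumann algebras ([tracial_of] below) and their
   ultrapowers ([ultrapower]) are instances, so the construction can be
   iterated.  [tauM_le] says that |xy|_2 <= |x| |y|_2. *)
Record tracialAlg (F : realType) := TracialAlg {
  ta_star :> starAlg F;
  opnorm : ta_star -> F;
  tau : ta_star -> F[i];
  opnorm_ge0 : forall x, 0 <= opnorm x;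
  opnormD : forall x y, opnorm (x + y) <= opnorm x + opnorm y;
  opnormZ : forall (c : F[i]) x, opnorm (c *: x) <= normc c * opnorm x;
  opnormM : forall x y, opnorm (x * y) <= opnorm x * opnorm y;
  opnorm_star : forall x, opnorm (star x) = opnorm x;
  tau_linear : scalar tau;
  tau1 : tau 1 = 1;
  tauC : forall x y, tau (x * y) = tau (y * x);
  tau_ge0 : forall x, 0 <= tau (star x * x);
  tau_eq0 : forall x, tau (star x * x) = 0 -> x = 0;
  tauM_le : forall x y, tau (star (x * y) * (x * y))
              <= ((opnorm x) ^+ 2)%:C * tau (star y * y) }.

HB.instance Definition _ F (A : tracialAlg F) :=
  @GRing.isLinear.Build _ _ _ _ (@tau F A) (@tau_linear F A).

Lemma ler_gt_mul (F : realType) (n b z : F) : 0 <= n ->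
  (forall d, b < d -> z <= n * d) -> z <= n * b.
Proof.
move=> n0 H; apply/ler_addgt0Pr => e e0.
have n1 : 0 < n + 1 by rewrite ltr_wpDl.
apply: (le_trans (H (b + e / (n + 1)) _)); first by rewrite ltrDl divr_gt0.
rewrite mulrDr lerD2l mulrCA -[leRHS]mulr1 ler_pM2l // ler_pdivrMr // mul1r.
by rewrite lerDl.
Qed.

Section StarFacts.
Context {F : realType} (A : starAlg F).
Implicit Types x y : A.

Lemma star0 : star (0 : A) = 0.
Proof. by apply: (addrI (star 0)); rewrite -starD !addr0. Qed.

Lemma starN x : star (- x) = - star x.
Proof. by apply: (addrI (star x)); rewrite -starD !subrr star0. Qed.

Lemma starB x y : star (x - y) = star x - star y.
Proof. by rewrite starD starN. Qed.

Lemma star1 : star (1 : A) = 1.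
Proof. by rewrite -[LHS]mulr1 -[X in _ * X](starK 1) -starM mulr1 starK. Qed.

End StarFacts.

Section TracialFacts.
Context {F : realType} (A : tracialAlg F).
Implicit Types x y : A.

Definition norm2sq x : F := complex.Re (tau (star x * x)).

Lemma tau_norm2sq x : tau (star x * x) = (norm2sq x)%:C.
Proof.
by have := tau_ge0 x; rewrite /norm2sq; case: (tau _) => a b; rewrite lecE /= => /andP[/eqP-> _].
Qed.

Lemma norm2sq_ge0 x : 0 <= norm2sq x.
Proof. by rewrite -ler0c -tau_norm2sq tau_ge0. Qed.

Lemma norm2sq_eq0 x : norm2sq x = 0 -> x = 0.
Proof. by move=> h; apply: tau_eq0; rewrite tau_norm2sq h. Qed.

Lemma norm2sq_star x : norm2sq (star x) = norm2sq x.
Proof. by rewrite /norm2sq starK tauC. Qed.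

Lemma norm2sqM x y : norm2sq (x * y) <= opnorm x ^+ 2 * norm2sq y.
Proof. by have := tauM_le x y; rewrite !tau_norm2sq -rmorphM /= lecR. Qed.

Lemma norm2sqMr x y : norm2sq (x * y) <= opnorm y ^+ 2 * norm2sq x.
Proof.
by rewrite -norm2sq_star starM (le_trans (norm2sqM _ _)) // opnorm_star norm2sq_star.
Qed.

Lemma norm2sqZ (c : F[i]) x : norm2sq (c *: x) = normc c ^+ 2 * norm2sq x.
Proof.
apply: complexI; rewrite -tau_norm2sq starZ -scalerAl -scalerAr !linearZ /=.
rewrite tau_norm2sq rmorphM rmorphXn /= mulrA; congr (_ * _).
by rewrite mulrC -normCK.
Qed.

Lemma norm2sqN x : norm2sq (- x) = norm2sq x.
Proof. by rewrite /norm2sq starN mulrNN. Qed.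

Lemma norm2sqD x y : norm2sq (x + y) <= 2 * (norm2sq x + norm2sq y).
Proof.
have : norm2sq (x + y) + norm2sq (x - y) = 2 * (norm2sq x + norm2sq y).
  apply: complexI; rewrite !(rmorphD, rmorphM) /= -!tau_norm2sq.
  rewrite starB starD !(mulrDl, mulrDr, mulrN, mulNr) !linearD !linearN /=.
  ring.
by have := norm2sq_ge0 (x - y); lra.
Qed.

Lemma opnormN x : opnorm (- x) <= opnorm x.
Proof.
have := opnormZ (-1) x; rewrite scaleN1r => /le_trans; apply.
by rewrite /= oppr0 expr0n addr0 sqrrN expr1n sqrtr1 mul1r.
Qed.

Lemma opnormB x y : opnorm (x - y) <= opnorm x + opnorm y.
Proof. by rewrite (le_trans (opnormD _ _)) // lerD2l opnormN. Qed.

Lemma norm2sq1 : norm2sq 1 = 1.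
Proof. by rewrite /norm2sq star1 mulr1 tau1. Qed.

Lemma norm2sq_opnorm x : norm2sq x <= opnorm x ^+ 2.
Proof. by have := norm2sqM x 1; rewrite norm2sq1 !mulr1. Qed.

Lemma tau_star x : tau (star x) = (tau x)^*.
Proof.
have h1 : 0 <= tau (star (x + 1) * (x + 1)) by exact: tau_ge0.
have h2 : 0 <= tau (star (x + 'i%:A) * (x + 'i%:A)) by exact: tau_ge0.
have h3 := tau_ge0 x.
move: h1 h2; rewrite !starD star1 starZ star1.
rewrite !(mulrDl, mulrDr) -!(scalerAl,scalerAr) !(mulr1,mul1r) scalerA !linearD !linearZ /= tau1.
move: h3; case: (tau (star x * x)) => n1 n2.
case: (tau (star x)) => a b; case: (tau x) => c d.
rewrite !lecE /= => /andP[/eqP-> _] /andP[/eqP h1 _] /andP[/eqP h2 _].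
by apply/eqP; rewrite eq_complex /=; apply/andP; split; apply/eqP; lra.
Qed.

Lemma tau_bound x : normc (tau x) ^+ 2 <= norm2sq x.
Proof.
have := norm2sq_ge0 (x - (tau x)%:A); rewrite -ler0c -tau_norm2sq.
rewrite starB starZ star1 !(mulrBl, mulrBr) -!(scalerAl,scalerAr) !(mulr1,mul1r) scalerA.
rewrite !linearB !linearZ /= tau1 tau_star tau_norm2sq.
case: (tau x) => a b; rewrite lecE /= => /andP[_] h.
by rewrite sqr_sqrtr ?addr_ge0 ?sqr_ge0 //; move: h; rewrite !expr2; lra.
Qed.

End TracialFacts.


Record ultrafilter (T : Type) := Ultrafilter {
  ultra_sets :> set_system T;
  ultra_class : UltraFilter ultra_sets }.
#[global] Existing Instance ultra_class.
HB.instance Definition _ T := gen_eqMixin (ultrafilter T).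
HB.instance Definition _ T := gen_choiceMixin (ultrafilter T).
HB.instance Definition _ T := isFiltered.Build T (ultrafilter T) (@ultra_sets T).

Definition free_ultrafilter T (om : ultrafilter T) :=
  \bigcap_(A in (om : set_system T)) A = set0.

(* The outer quantifier runs along the first factor: the limit along
   [tensor U V] of f (i, j) is the limit along i -> U of the limit along
   j -> V of f (i, j).  Hence the iterated ultrapower (M^V)^U, with U applied
   last, is the one that goes with [tensor U V]. *)
Section Tensor.
Context {I J : Type} (U : ultrafilter I) (V : ultrafilter J).

Definition tensor_sets : set_system (I * J) :=
  [set X | (U : set_system I) [set i | (V : set_system J) [set j | X (i, j)]]].

Lemma tensor_ultra : UltraFilter tensor_sets.
Proof.
have PF : ProperFilter tensor_sets.
  apply: Build_ProperFilter_ex.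
    by move=> X /(@filter_ex _ U)[i /(@filter_ex _ V)[j Xij]]; exists (i, j).
  split.
  - by apply: (@filterE _ U) => i; apply: (@filterE _ V).
  - move=> X Y UX UY; apply: (@filterS2 _ U) UX UY => i Xi Yi.
    by apply: (@filterS2 _ V) Xi Yi => j Xij Yij; split.
  - move=> X Y XY; apply: (@filterS _ U) => i; apply: (@filterS _ V) => j; exact: XY.
split=> // G PG sG; rewrite predeqE => X; split; last exact: sG.
move=> GX; have [UX//|UX] :=
  in_ultra_setVsetC [set i | (V : set_system J) [set j | X (i, j)]] (ultra_class U).
have /sG GnX : tensor_sets (~` X).
  apply: (@filterS _ U) UX => i /= nVi.
  by have [//|] := in_ultra_setVsetC [set j | X (i, j)] (ultra_class V).
by have /filter_ex[? []] : G (X `&` ~` X) by exact: filterI.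
Qed.

Definition tensor : ultrafilter (I * J) := Ultrafilter tensor_ultra.

End Tensor.

Section UltraLimit.
Context {F : realType} {K : Type} (om : ultrafilter K).

Lemma ultra_cvg (f : K -> F) (c : F) : (forall k, `|f k| <= c) ->
  f @ om --> lim (f @ om).
Proof.
move=> fc.
have FU : UltraFilter (f @ om).
  split=> [|G PG sG]; first exact: fmap_proper_filter.
  rewrite predeqE => X; split; last exact: sG.
  move=> GX; have [UX//|UX] := in_ultra_setVsetC (f @^-1` X) (ultra_class om).
  have /sG GnX : (f @ om) (~` X) by exact: UX.
  by have /filter_ex[? []] : G (X `&` ~` X) by exact: filterI.
have := @segment_compact F (- c) c; rewrite compact_ultra.
move=> /(_ _ FU)[|l [_ fl]].
  by apply: (@filterE _ om) => k /=; rewrite in_itv /= -ler_norml.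
by apply/cvg_ex; exists l.
Qed.

Lemma ultra_lim (f : K -> F) l : f @ om --> l -> lim (f @ om) = l.
Proof. exact: cvg_lim. Qed.

(* the limit in F[i] along the ultrafilter, computed componentwise *)
Definition clim (z : K -> F[i]) : F[i] :=
  lim ((fun k => complex.Re (z k)) @ om) +i* lim ((fun k => complex.Im (z k)) @ om).

Lemma normc_Re (z : F[i]) : `|complex.Re z| <= normc z.
Proof.
by case: z => a b /=; rewrite -sqrtr_sqr ler_wsqrtr // lerDl sqr_ge0.
Qed.

Lemma normc_Im (z : F[i]) : `|complex.Im z| <= normc z.
Proof.
by case: z => a b /=; rewrite -sqrtr_sqr ler_wsqrtr // lerDr sqr_ge0.
Qed.

Lemma climP (z : K -> F[i]) (c : F) : (forall k, normc (z k) <= c) ->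
  (fun k => complex.Re (z k)) @ om --> complex.Re (clim z) /\
  (fun k => complex.Im (z k)) @ om --> complex.Im (clim z).
Proof.
by move=> zc; split; apply: (@ultra_cvg _ c) => k; apply: le_trans (zc k);
  [exact: normc_Re|exact: normc_Im].
Qed.

Lemma clim_eq (z : K -> F[i]) (l : F[i]) :
  (fun k => complex.Re (z k)) @ om --> complex.Re l ->
  (fun k => complex.Im (z k)) @ om --> complex.Im l -> clim z = l.
Proof.
by move=> h1 h2; rewrite /clim (ultra_lim h1) (ultra_lim h2); case: {h1 h2} l.
Qed.

End UltraLimit.

(* The *-algebra of bounded families, with pointwise operations. *)
Section Linf.
Context {F : realType} (K : Type) (A : tracialAlg F).

Definition is_bounded : {pred K -> A} :=
  [pred x : K -> A | `[< exists c : F, forall k, opnorm (x k) <= c >]].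

Lemma is_boundedP (x : K -> A) :
  reflect (exists c : F, forall k, opnorm (x k) <= c) (x \in is_bounded).
Proof. exact: asboolP. Qed.

Lemma is_bounded_subring : subring_closed is_bounded.
Proof.
split.
- by apply/is_boundedP; exists (opnorm (1 : A)).
- move=> x y /is_boundedP[c xc] /is_boundedP[d yd]; apply/is_boundedP.
  by exists (c + d) => k; rewrite (le_trans (opnormB _ _)) // lerD.
- move=> x y /is_boundedP[c xc] /is_boundedP[d yd]; apply/is_boundedP.
  exists (c * d) => k; rewrite (le_trans (opnormM _ _)) //.
  by rewrite ler_pM ?opnorm_ge0.
Qed.

HB.instance Definition _ :=
  GRing.isSubringClosed.Build _ is_bounded is_bounded_subring.

Lemma is_bounded_scaler : GRing.scaler_closed is_bounded.
Proof.
move=> a x /is_boundedP[c xc]; apply/is_boundedP; exists (normc a * c) => k.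
rewrite (le_trans (opnormZ _ _)) // ler_wpM2l //.
by case: (a) => ? ?; exact: sqrtr_ge0.
Qed.

HB.instance Definition _ :=
  GRing.isScaleClosed.Build _ _ is_bounded is_bounded_scaler.

Record linf := Linf {
  linf_val :> K -> A;
  linf_bounded : linf_val \in is_bounded }.

HB.instance Definition _ := [isSub for linf_val].
HB.instance Definition _ := [Choice of linf by <:].
HB.instance Definition _ := 
  GRing.SubChoice_isSubPzRing.Build _ _ linf (GRing.subringClosedP _).
HB.instance Definition _ := [SubZmodule_isSubLmodule of linf by <:].

Lemma linfP (x : linf) : exists2 c : F, 0 <= c & forall k, opnorm (x k) <= c.
Proof.
have /is_boundedP[c xc] := linf_bounded x; exists `|c| => // k.
by rewrite (le_trans (xc k)) // ler_norm.
Qed.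

Lemma linf_star_subproof (x : linf) :
  (fun k => star (x k)) \in is_bounded.
Proof.
have [c _ xc] := linfP x; apply/is_boundedP; exists c => k.
by rewrite opnorm_star.
Qed.

Definition linf_star (x : linf) : linf := Linf (linf_star_subproof x).

End Linf.

Section Ultrapower.
Context {F : realType} {K : Type} (A : tracialAlg F) (om : ultrafilter K).
Local Notation L := (linf K A).
Implicit Types x y : L.

(* the 2-norm null families, by which [linf K A] is divided *)
Definition null_ideal : {pred L} :=
  [pred x : L | `[< (fun k => norm2sq (x k)) @ om --> (0 : F) >]].

Lemma null_idealP x :
  reflect ((fun k => norm2sq (x k)) @ om --> (0 : F)) (x \in null_ideal).
Proof. exact: asboolP. Qed.

Lemma null_squeeze (f g : K -> F) : (forall k, 0 <= f k <= g k) ->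
  g @ om --> (0 : F) -> f @ om --> (0 : F).
Proof.
move=> fg g0; apply: (squeeze_cvgr (f := cst 0) (h := g)) => //.
  by apply: (@filterE _ om).
exact: cvg_cst.
Qed.

Lemma ultra_le (f g : K -> F) (l m : F) : f @ om --> l -> g @ om --> m ->
  (forall k, f k <= g k) -> l <= m.
Proof.
move=> fl gm fg; have h : (fun k => g k - f k) @ om --> m - l by exact: cvgB.
rewrite -subr_ge0 -(ultra_lim h); apply: limr_ge; first by apply/cvg_ex; exists (m - l).
by apply: (@filterE _ om) => k; rewrite subr_ge0.
Qed.

Lemma cvg_eqfun (f g : K -> F) (l : F) : f =1 g ->
  f @ om --> l -> g @ om --> l.
Proof. by move=> /funext->. Qed.

Lemma cvgD0 (f g : K -> F) (l : F) : f @ om --> l -> g @ om --> (0 : F) ->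
  (fun k => f k + g k) @ om --> l.
Proof. by move=> fl g0; rewrite -[X in _ --> X]addr0; exact: cvgD. Qed.

Lemma null_ideal_zmod : zmod_closed null_ideal.
Proof.
split.
  apply/null_idealP; rewrite (_ : (fun _ => _) = cst 0); first exact: cvg_cst.
  apply/funext => k /=; rewrite -[LHS]/(norm2sq (0 : A)).
  by rewrite /norm2sq mulr0 linear0.
move=> x y /null_idealP x0 /null_idealP y0; apply/null_idealP.
apply: (@null_squeeze _ (fun k => 2 * (norm2sq (x k) + norm2sq (y k)))).
  move=> k; rewrite norm2sq_ge0 /= -(norm2sqN (y k)); exact: norm2sqD.
have e : (0 : F) = 2 * (0 + 0) by rewrite addr0 mulr0.
by rewrite [X in _ --> X]e; apply: cvgM; [exact: cvg_cst|exact: cvgD].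
Qed.

HB.instance Definition _ := GRing.isZmodClosed.Build _ null_ideal null_ideal_zmod.

Lemma null_le (c : F) (x y : L) :
  (forall k, norm2sq (y k) <= c * norm2sq (x k)) ->
  x \in null_ideal -> y \in null_ideal.
Proof.
move=> yx /null_idealP x0; apply/null_idealP.
apply: (@null_squeeze _ (fun k => c * norm2sq (x k))).
  by move=> k; rewrite norm2sq_ge0 yx.
have e : (0 : F) = c * 0 by rewrite mulr0.
by rewrite [X in _ --> X]e; apply: cvgM => //; exact: cvg_cst.
Qed.

Lemma null_mull x y : y \in null_ideal -> x * y \in null_ideal.
Proof.
have [c c0 xc] := linfP x; apply: (@null_le (c ^+ 2)) => k.
rewrite (le_trans (norm2sqM _ _)) // ler_wpM2r ?norm2sq_ge0 //.
by rewrite lerXn2r ?nnegrE ?opnorm_ge0 //; apply: xc.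
Qed.

Lemma null_mulr x y : x \in null_ideal -> x * y \in null_ideal.
Proof.
have [c c0 yc] := linfP y; apply: (@null_le (c ^+ 2)) => k.
rewrite (le_trans (norm2sqMr _ _)) // ler_wpM2r ?norm2sq_ge0 //.
by rewrite lerXn2r ?nnegrE ?opnorm_ge0 //; apply: yc.
Qed.

Lemma null_scale (a : F[i]) x : x \in null_ideal -> a *: x \in null_ideal.
Proof.
by apply: (@null_le (normc a ^+ 2)) => k; rewrite -norm2sqZ; exact: lexx.
Qed.

Lemma null_star x : x \in null_ideal -> linf_star x \in null_ideal.
Proof. by apply: (@null_le 1) => k; rewrite mul1r norm2sq_star; exact: lexx. Qed.

Definition upower := Quotient.quot null_ideal.
HB.instance Definition _ := Choice.on upower.
HB.instance Definition _ := GRing.Zmodule.on upower.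

Implicit Types u v w : upower.

Definition upi (x : L) : upower := \pi x.
Definition urepr (u : upower) : L := repr u.

Lemma ureprK u : upi (urepr u) = u.
Proof. exact: reprK. Qed.

Lemma upi_eq x y : (upi x = upi y) <-> (x - y \in null_ideal).
Proof.
by rewrite Quotient.idealrBE; exact: (rwP eqP).
Qed.

Lemma upiK x : urepr (upi x) - x \in null_ideal.
Proof. by apply/upi_eq; rewrite ureprK. Qed.

Lemma upiD x y : upi (x + y) = upi x + upi y.
Proof. exact: (Quotient.pi_add). Qed.

Lemma upiN x : upi (- x) = - upi x.
Proof. exact: (Quotient.pi_opp). Qed.

Lemma upi0 : upi 0 = 0.
Proof. by apply: (addrI (upi 0)); rewrite -upiD !addr0. Qed.

Definition uone := upi 1.
Definition umul u v := upi (urepr u * urepr v).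
Definition uscale (a : F[i]) u := upi (a *: urepr u).
Definition ustar u := upi (linf_star (urepr u)).

Lemma upiM x y : upi (x * y) = umul (upi x) (upi y).
Proof.
apply/esym/upi_eq; set x' := urepr _; set y' := urepr _.
have -> : x' * y' - x * y = (x' - x) * y' + x * (y' - y).
  by rewrite mulrBl mulrBr addrA subrK.
by apply: rpredD; [apply: null_mulr|apply: null_mull]; exact: upiK.
Qed.

Lemma upiZ a x : upi (a *: x) = uscale a (upi x).
Proof. by apply/esym/upi_eq; rewrite -scalerBr null_scale ?upiK. Qed.

Lemma upi_star x : upi (linf_star x) = ustar (upi x).
Proof.
apply/esym/upi_eq.
rewrite (_ : _ - _ = linf_star (urepr (upi x) - x)) ?null_star ?upiK //.
by apply/val_inj/funext => k; rewrite /= -[RHS]/(star (_ - _)) starB.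
Qed.

Lemma upi_ind (P : upower -> Prop) : (forall x, P (upi x)) -> forall u, P u.
Proof. by move=> H u; rewrite -(ureprK u). Qed.

Lemma umulA : associative umul.
Proof.
by elim/upi_ind => x; elim/upi_ind => y; elim/upi_ind => z; rewrite -!upiM mulrA.
Qed.

Lemma umul1 : left_id uone umul.
Proof. by elim/upi_ind => x; rewrite -upiM mul1r. Qed.

Lemma umulr1 : right_id uone umul.
Proof. by elim/upi_ind => x; rewrite -upiM mulr1. Qed.

Lemma umulDl : left_distributive umul +%R.
Proof.
elim/upi_ind => x; elim/upi_ind => y; elim/upi_ind => z.
by rewrite -!(upiM, upiD) mulrDl.
Qed.

Lemma umulDr : right_distributive umul +%R.
Proof.
elim/upi_ind => x; elim/upi_ind => y; elim/upi_ind => z.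
by rewrite -!(upiM, upiD) mulrDr.
Qed.

Lemma norm2sq_cvg x :
  (fun k => norm2sq (x k)) @ om --> lim ((fun k => norm2sq (x k)) @ om).
Proof.
have [c c0 xc] := linfP x; apply: (@ultra_cvg _ _ _ _ (c ^+ 2)) => k.
rewrite ger0_norm ?norm2sq_ge0 // (le_trans (norm2sq_opnorm _)) //.
by rewrite lerXn2r ?nnegrE ?opnorm_ge0 //; apply: xc.
Qed.

Lemma normc_tau (a : A) : normc (tau a) <= opnorm a.
Proof.
rewrite -(@ler_pXn2r _ 2) ?nnegrE ?opnorm_ge0 //; last first.
  by case: (tau a) => ? ?; exact: sqrtr_ge0.
exact: le_trans (tau_bound a) (norm2sq_opnorm a).
Qed.

Definition utau u : F[i] := clim om (fun k => tau (urepr u k)).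

Lemma tau_cvg x :
  (fun k => complex.Re (tau (x k))) @ om
    --> complex.Re (clim om (fun k => tau (x k))) /\
  (fun k => complex.Im (tau (x k))) @ om
    --> complex.Im (clim om (fun k => tau (x k))).
Proof.
have [c c0 xc] := linfP x; apply: (@climP _ _ _ _ c) => k.
exact: le_trans (normc_tau _) (xc k).
Qed.

Lemma null_tau x : x \in null_ideal ->
  (fun k => normc (tau (x k)) ^+ 2) @ om --> (0 : F).
Proof.
move=> /null_idealP; apply: null_squeeze => k.
by rewrite sqr_ge0 tau_bound.
Qed.

Lemma sqr_cvg0 (f : K -> F) : (fun k => f k ^+ 2) @ om --> (0 : F) ->
  f @ om --> (0 : F).
Proof.
move=> /cvgr0Pnorm_lt f0; apply/cvgr0Pnorm_lt => e e0.
have := f0 (e ^+ 2); rewrite exprn_gt0 // => /(_ isT); apply: (@filterS _ om) => k /=.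
by rewrite normrX ltr_pXn2r ?nnegrE // ltW.
Qed.

Lemma utauE x : utau (upi x) = clim om (fun k => tau (x k)).
Proof.
have /null_tau d0 := upiK x.
have [hR hI] := tau_cvg x.
have dR : (fun k => complex.Re (tau ((urepr (upi x) - x) k))) @ om --> (0 : F).
  apply: sqr_cvg0; apply: null_squeeze d0 => k; rewrite sqr_ge0 /=.
  rewrite -real_normK ?num_real // lerXn2r ?nnegrE ?normc_Re //.
  by case: (tau _) => ? ?; exact: sqrtr_ge0.
have dI : (fun k => complex.Im (tau ((urepr (upi x) - x) k))) @ om --> (0 : F).
  apply: sqr_cvg0; apply: null_squeeze d0 => k; rewrite sqr_ge0 /=.
  rewrite -real_normK ?num_real // lerXn2r ?nnegrE ?normc_Im //.
  by case: (tau _) => ? ?; exact: sqrtr_ge0.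
have eT k : tau (urepr (upi x) k) = tau (x k) + tau ((urepr (upi x) - x) k).
  by rewrite -linearD /= -[X in _ = tau (_ + X)]/(_ - _) addrC subrK.
apply: clim_eq.
  apply: (cvg_eqfun _ (cvgD0 hR dR)) => k /=.
  by rewrite eT; case: (tau _) (tau _) => ? ? [].
apply: (cvg_eqfun _ (cvgD0 hI dI)) => k /=.
by rewrite eT; case: (tau _) (tau _) => ? ? [].
Qed.


Lemma uone_neq0 : uone != 0.
Proof.
apply/eqP; rewrite /uone -upi0 => /upi_eq; rewrite subr0 => /null_idealP.
rewrite (_ : (fun _ => _) = cst 1); last first.
  by apply/funext => k; exact: norm2sq1.
move=> /(ultra_lim) h; have : lim (cst (1 : F) @ om) = 1.
  by apply: ultra_lim; exact: cvg_cst.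
by rewrite h => /eqP; rewrite eq_sym oner_eq0.
Qed.

HB.instance Definition _ := GRing.Zmodule_isNzRing.Build upower
  umulA umul1 umulr1 umulDl umulDr uone_neq0.

Lemma uscaleA a b u : uscale a (uscale b u) = uscale (a * b) u.
Proof. by elim/upi_ind: u => x; rewrite -!upiZ scalerA. Qed.

Lemma uscale1 : left_id 1 uscale.
Proof. by elim/upi_ind => x; rewrite -!upiZ scale1r. Qed.

Lemma uscaleDr : right_distributive uscale +%R.
Proof.
by move=> a; elim/upi_ind => x; elim/upi_ind => y; rewrite -!(upiZ, upiD) scalerDr.
Qed.

Lemma uscaleDl u : {morph uscale^~ u : a b / a + b}.
Proof. by move=> a b; elim/upi_ind: u => x; rewrite -!(upiZ, upiD) scalerDl. Qed.

HB.instance Definition _ := GRing.Zmodule_isLmodule.Build F[i] upower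
  uscaleA uscale1 uscaleDr uscaleDl.

Lemma uscaleAl a u v : a *: (u * v) = (a *: u) * v.
Proof.
elim/upi_ind: u => x; elim/upi_ind: v => y.
rewrite /GRing.scale /GRing.mul /= -!(upiM, upiZ); congr upi.
by apply/val_inj/funext => k; exact: scalerAl.
Qed.

HB.instance Definition _ := GRing.Lmodule_isLalgebra.Build F[i] upower uscaleAl.

Lemma uscaleAr a u v : a *: (u * v) = u * (a *: v).
Proof.
elim/upi_ind: u => x; elim/upi_ind: v => y.
rewrite /GRing.scale /GRing.mul /= -!(upiM, upiZ); congr upi.
by apply/val_inj/funext => k; exact: scalerAr.
Qed.

HB.instance Definition _ := GRing.Lalgebra_isAlgebra.Build F[i] upower uscaleAr.

Lemma upiM' x y : upi (x * y) = upi x * upi y.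
Proof. exact: upiM. Qed.

Lemma upiZ' a x : upi (a *: x) = a *: upi x.
Proof. exact: upiZ. Qed.

Lemma norm2sq_utau x :
  utau (ustar (upi x) * upi x) =
  (lim ((fun k => norm2sq (x k)) @ om))%:C.
Proof.
rewrite -upi_star -upiM' utauE; apply: clim_eq; first exact: norm2sq_cvg.
rewrite (_ : (fun _ => _) = cst 0); first exact: cvg_cst.
apply/funext => k /=; rewrite -[X in tau X]/(star (x k) * x k).
by rewrite tau_norm2sq.
Qed.

Lemma ustarD : {morph ustar : u v / u + v}.
Proof.
elim/upi_ind => x; elim/upi_ind => y; rewrite -!(upiD, upi_star); congr upi.
by apply/val_inj/funext => k; exact: starD.
Qed.

Lemma ustarZ a u : ustar (a *: u) = a^* *: ustar u.
Proof.
elim/upi_ind: u => x; rewrite -!(upiZ', upi_star); congr upi.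
by apply/val_inj/funext => k; exact: starZ.
Qed.

Lemma ustarM u v : ustar (u * v) = ustar v * ustar u.
Proof.
elim/upi_ind: u => x; elim/upi_ind: v => y.
rewrite -!(upiM', upi_star); congr upi.
by apply/val_inj/funext => k; exact: starM.
Qed.

Lemma ustarK : involutive ustar.
Proof.
elim/upi_ind => x; rewrite -!upi_star; congr upi.
by apply/val_inj/funext => k; exact: starK.
Qed.

Definition upower_star : starAlg F :=
  @StarAlg F upower ustar ustarD ustarZ ustarM ustarK.

(* [unorm] is the quotient norm: the infimum, over the representatives x of u,
   of sup_k |x_k| *)
Definition unorm_bounds u : set F :=
  [set c | exists x, upi x = u /\ forall k, opnorm (x k) <= c].

Definition unorm u : F := inf (unorm_bounds u).

Lemma ultra_point : exists k : K, True.
Proof. by have /(@filter_ex _ om)[k _] : (om : set_system K) setT by exact: filterT; exists k. Qed.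

Lemma unorm_has_inf u : has_inf (unorm_bounds u).
Proof.
split.
  by elim/upi_ind: u => x; have [c _ xc] := linfP x; exists c, x.
exists 0 => c [x [_ xc]]; have [k _] := ultra_point.
exact: le_trans (opnorm_ge0 _) (xc k).
Qed.

Lemma unorm_le x c : (forall k, opnorm (x k) <= c) -> unorm (upi x) <= c.
Proof.
move=> xc; apply: ge_inf; last by exists x.
by case: (unorm_has_inf (upi x)).
Qed.

Lemma unorm_lt u c : unorm u < c ->
  exists x, upi x = u /\ forall k, opnorm (x k) <= c.
Proof.
rewrite /unorm => uc; have [d [x [xu xd]] dc] := inf_lt (unorm_has_inf u).1 uc.
by exists x; split=> // k; apply: le_trans (xd k) (ltW dc).
Qed.

Lemma unorm_ge0 u : 0 <= unorm u.
Proof.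
apply: lb_le_inf; first by case: (unorm_has_inf u).
move=> c [x [_ xc]]; have [k _] := ultra_point.
exact: le_trans (opnorm_ge0 _) (xc k).
Qed.

Lemma unormD u v : unorm (u + v) <= unorm u + unorm v.
Proof.
apply/ler_addgt0Pr => e e0.
have [|x [<- xc]] := @unorm_lt u (unorm u + e / 2); first by rewrite ltrDl divr_gt0.
have [|y [<- yc]] := @unorm_lt v (unorm v + e / 2); first by rewrite ltrDl divr_gt0.
rewrite -upiD (_ : _ + e = unorm (upi x) + e / 2 + (unorm (upi y) + e / 2)); last by lra.
apply: unorm_le => k; apply: le_trans (opnormD _ _) _.
by apply: lerD; [exact: xc|exact: yc].
Qed.

Lemma unormZ a u : unorm (a *: u) <= normc a * unorm u.
Proof.
have a0 : 0 <= normc a by case: (a) => ? ?; exact: sqrtr_ge0.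
apply: ler_gt_mul => // c /unorm_lt[x [<- xc]]; rewrite -upiZ'.
apply: unorm_le => k; apply: le_trans (opnormZ _ _) _.
by apply: ler_wpM2l => //; exact: xc.
Qed.

Lemma unormM u v : unorm (u * v) <= unorm u * unorm v.
Proof.
apply: ler_gt_mul => [|d vd]; first exact: unorm_ge0.
have d0 : 0 <= d by rewrite (le_trans (unorm_ge0 v)) // ltW.
rewrite mulrC; apply: ler_gt_mul => // c uc.
have [x [<- xc]] := unorm_lt uc; have [y [<- yd]] := unorm_lt vd.
rewrite -upiM'; apply: unorm_le => k; rewrite (le_trans (opnormM _ _)) //.
by rewrite mulrC ler_pM ?opnorm_ge0 //; [exact: yd|exact: xc].
Qed.

Lemma unorm_star u : unorm (ustar u) = unorm u.
Proof.
suff H v : unorm (ustar v) <= unorm v.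
  by apply/le_anti; rewrite H /= -{1}(ustarK u) H.
apply/ler_addgt0Pr => e e0.
have [|x [<- xc]] := @unorm_lt v (unorm v + e); first by rewrite ltrDl.
by rewrite -upi_star; apply: unorm_le => k; rewrite opnorm_star.
Qed.

Lemma utau_linear : scalar utau.
Proof.
move=> a; elim/upi_ind => x; elim/upi_ind => y; rewrite -upiZ' -upiD !utauE.
have [xR xI] := tau_cvg x; have [yR yI] := tau_cvg y.
apply: clim_eq.
  rewrite (_ : complex.Re _ = complex.Re a * complex.Re (clim om (fun k => tau (x k)))
     - complex.Im a * complex.Im (clim om (fun k => tau (x k)))
     + complex.Re (clim om (fun k => tau (y k)))); last first.
    by case: (clim _ _) (clim _ _) (a) => ? ? [? ?] [? ?].
  apply: (@cvg_eqfun (fun k => complex.Re a * complex.Re (tau (x k))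
     - complex.Im a * complex.Im (tau (x k)) + complex.Re (tau (y k)))).
    move=> k; rewrite -[X in _ = complex.Re (tau X)]/(a *: x k + y k) linearP /=.
    by case: (tau _) (tau _) (a) => ? ? [? ?] [? ?].
  by apply: cvgD => //; apply: cvgB; apply: cvgM => //; exact: cvg_cst.
rewrite (_ : complex.Im _ = complex.Re a * complex.Im (clim om (fun k => tau (x k)))
   + complex.Im a * complex.Re (clim om (fun k => tau (x k)))
   + complex.Im (clim om (fun k => tau (y k)))); last first.
  by case: (clim _ _) (clim _ _) (a) => ? ? [? ?] [? ?].
apply: (@cvg_eqfun (fun k => complex.Re a * complex.Im (tau (x k))
   + complex.Im a * complex.Re (tau (x k)) + complex.Im (tau (y k)))).
  move=> k; rewrite -[X in _ = complex.Im (tau X)]/(a *: x k + y k) linearP /=.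
  by case: (tau _) (tau _) (a) => ? ? [? ?] [? ?].
by apply: cvgD => //; apply: cvgD; apply: cvgM => //; exact: cvg_cst.
Qed.

Lemma utau1 : utau 1 = 1.
Proof.
rewrite -[X in utau X]/(upi 1) utauE; apply: clim_eq.
  by apply: (@cvg_eqfun (cst 1)); [move=> k; rewrite /= tau1|exact: cvg_cst].
by apply: (@cvg_eqfun (cst 0)); [move=> k; rewrite /= tau1|exact: cvg_cst].
Qed.

Lemma utauC u v : utau (u * v) = utau (v * u).
Proof.
elim/upi_ind: u => x; elim/upi_ind: v => y; rewrite -!upiM' !utauE.
by congr (clim om _); apply/funext => k; exact: tauC.
Qed.

Lemma utau_ge0 u : 0 <= utau (ustar u * u).
Proof.
elim/upi_ind: u => x; rewrite norm2sq_utau ler0c.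
apply: limr_ge; first by apply/cvg_ex; eexists; exact: norm2sq_cvg.
by apply: (@filterE _ om) => k; exact: norm2sq_ge0.
Qed.

Lemma utau_eq0 u : utau (ustar u * u) = 0 -> u = 0.
Proof.
elim/upi_ind: u => x; rewrite norm2sq_utau => -[h].
rewrite -upi0; apply/upi_eq; rewrite subr0; apply/null_idealP.
by rewrite -[X in _ --> X]h; exact: norm2sq_cvg.
Qed.

Lemma utauM_le u v : utau (ustar (u * v) * (u * v))
  <= (unorm u ^+ 2)%:C * utau (ustar v * v).
Proof.
elim/upi_ind: v => y.
set n := lim ((fun k => norm2sq (y k)) @ om).
have n0 : 0 <= n by rewrite -ler0c -norm2sq_utau utau_ge0.
have H c : unorm u < c ->
    utau (ustar (u * upi y) * (u * upi y)) <= (c * c * n)%:C.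
  move=> /unorm_lt[x [<- xc]].
  rewrite -upiM' norm2sq_utau lecR.
  apply: (@ultra_le _ _ _ _ (@norm2sq_cvg (x * y))
     (cvgM (cvg_cst (c * c)) (@norm2sq_cvg y))) => k /=; rewrite (le_trans (norm2sqM _ _)) //.
  rewrite ler_wpM2r ?norm2sq_ge0 // expr2.
  by rewrite ler_pM ?opnorm_ge0 //; apply: xc.
move: H; rewrite norm2sq_utau -/n; elim/upi_ind: u => x.
rewrite -upiM' norm2sq_utau; set m := lim _; rewrite -rmorphM /= lecR => H.
have u0 := unorm_ge0 (upi x).
have H2 c d : unorm (upi x) < c -> unorm (upi x) < d -> m <= c * n * d.
  move=> uc ud; have := H (Num.min c d); rewrite lt_min uc ud lecR => /(_ isT).
  move=> /le_trans; apply; rewrite [leRHS]mulrAC ler_wpM2r //.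
  have m0 : 0 <= Num.min c d by rewrite le_min !(le_trans u0) // ltW.
  by rewrite ler_pM // ge_min lexx ?orbT.
rewrite (_ : _ * n = n * unorm (upi x) * unorm (upi x)); last by ring.
apply: ler_gt_mul => [|c uc]; first exact: mulr_ge0.
rewrite (_ : _ * c = c * n * unorm (upi x)); last by ring.
apply: ler_gt_mul => [|d ud]; last exact: H2.
by rewrite mulr_ge0 // (le_trans u0) // ltW.
Qed.

Definition ultrapower : tracialAlg F :=
  @TracialAlg F upower_star unorm utau unorm_ge0 unormD unormZ unormM unorm_star
    utau_linear utau1 utauC utau_ge0 utau_eq0 utauM_le.

End Ultrapower.

(* [inner] is linear in its first argument and conjugate-linear in the second;
   completeness is phrased with squared distances. *)
Record hilbert (F : realType) := Hilbert {
  hs_space :> lmodType F[i];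
  inner : {dot hs_space for Num.conj};
  hs_complete : forall u : nat -> hs_space,
    (forall e : F, 0 < e -> exists N : nat, forall m n : nat,
       (N <= m)%N -> (N <= n)%N -> inner (u m - u n) (u m - u n) < e%:C) ->
    exists l, forall e : F, 0 < e -> exists N : nat, forall n : nat,
       (N <= n)%N -> inner (u n - l) (u n - l) < e%:C }.

Section HilbertOperators.
Context {F : realType} {H : hilbert F}.

Definition hnorm (x : H) : F := Num.sqrt (complex.Re (inner H x x)).

(* [T] is a plain function, so linearity is part of the definition. *)
Definition bounded_operator (T : H -> H) :=
  linear T /\ exists c : F, forall x, hnorm (T x) <= c * hnorm x.

Definition commutant (S : set (H -> H)) : set (H -> H) :=
  [set T | bounded_operator T /\ forall s, S s -> T \o s = s \o T].

Definition bicommutant (S : set (H -> H)) := commutant (commutant S).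

End HilbertOperators.

(* A von Neumann algebra, given with its action on a Hilbert space: [vn_act]
   identifies [vn_alg] with a unital *-algebra of bounded operators that is
   equal to its bicommutant. *)
Record vonNeumannAlg (F : realType) := VonNeumannAlg {
  vn_alg :> starAlg F;
  vn_space : hilbert F;
  vn_act : vn_alg -> vn_space -> vn_space;
  vn_act_bounded : forall a, bounded_operator (vn_act a);
  vn_act_linear : forall x, linear (vn_act^~ x);
  vn_act1 : vn_act 1 = id;
  vn_actM : forall a b, vn_act (a * b) = vn_act a \o vn_act b;
  vn_act_star : forall a x y,
    inner vn_space (vn_act a x) y = inner vn_space x (vn_act (star a) y);
  vn_act_inj : injective vn_act;
  vn_bicommutant : bicommutant (range vn_act) `<=` range vn_act }.

Section VonNeumann.
Context {F : realType} (M : vonNeumannAlg F).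

Definition vn_pos (a : M) := forall x, 0 <= inner (vn_space M) (vn_act a x) x.

Definition vn_le (a b : M) := vn_pos (b - a).

Definition vn_lub (D : set M) (s : M) :=
  (forall d, D d -> vn_le d s) /\
  (forall u, (forall d, D d -> vn_le d u) -> vn_le s u).

Definition directed (D : set M) :=
  D !=set0 /\ forall a b, D a -> D b -> exists c, [/\ D c, vn_le a c & vn_le b c].

(* Normality as preservation of suprema of increasing nets of positive
   elements, the nets being given by their (directed) ranges. *)
Definition normal_functional (f : M -> F[i]) :=
  forall (D : set M) (s : M), (forall d, D d -> vn_pos d) -> directed D ->
    vn_lub D s -> complex.Re (f s) = sup [set complex.Re (f d) | d in D].

Record faithful_normal_trace := FaithfulNormalTrace {
  fnt :> M -> F[i];
  fnt_linear : scalar fnt;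
  fnt1 : fnt 1 = 1;
  fnt_pos : forall a, vn_pos a -> 0 <= fnt a;
  fntC : forall a b, fnt (a * b) = fnt (b * a);
  fnt_faithful : forall a, fnt (star a * a) = 0 -> a = 0;
  fnt_normal : normal_functional fnt }.

Definition factor :=
  forall z : M, (forall a, z * a = a * z) -> exists c : F[i], z = c%:A.

Definition finite_vn := forall v : M, star v * v = 1 -> v * star v = 1.

Definition projection (p : M) := star p = p /\ p * p = p.

Definition abelian_projection (p : M) :=
  projection p /\
  forall a b, (p * a * p) * (p * b * p) = (p * b * p) * (p * a * p).

(* type II_1: finite, and without non-zero abelian projections *)
Definition type_II1 := finite_vn /\ forall p, abelian_projection p -> p = 0.

Definition fd_star_subalgebra (B : set M) :=
  [/\ B 1,
      forall (c : F[i]) a b, B a -> B b -> B (c *: a + b),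
      forall a b, B a -> B b -> B (a * b),
      forall a, B a -> B (star a) &
      exists s : seq M, forall b, B b ->
        exists c : nat -> F[i], b = \sum_(i < size s) c i *: s`_i].

(* Generated, as a von Neumann algebra, by an increasing sequence of
   finite-dimensional unital *-subalgebras. *)
Definition hyperfinite := exists B : nat -> set M,
  [/\ forall n, fd_star_subalgebra (B n),
      forall n, B n `<=` B n.+1 &
      range (@vn_act F M) `<=` bicommutant (@vn_act F M @` \bigcup_n B n)].

Definition hyperfinite_II1_factor := [/\ factor, type_II1 & hyperfinite].

End VonNeumann.

Section HilbertFacts.
Context {F : realType} {H : hilbert F}.
Implicit Types x y : H.
Local Notation "'<< x , y >>" := (inner H x y).

Lemma inner_self x : '<<x, x>> = (hnorm x ^+ 2)%:C.
Proof.
have := dnorm_ge0 (inner H) x; rewrite /hnorm.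
case: '<<x, x>> => a b; rewrite lecE /= => /andP[/eqP-> a0].
by rewrite sqr_sqrtr.
Qed.

Lemma hnorm_ge0 x : 0 <= hnorm x.
Proof. exact: sqrtr_ge0. Qed.

Lemma inner_CS x y : normc '<<x, y>> <= hnorm x * hnorm y.
Proof.
have n0 : 0 <= normc '<<x, y>> by case: '<<x, y>> => ? ?; exact: sqrtr_ge0.
rewrite -(@ler_pXn2r _ 2) ?nnegrE ?mulr_ge0 ?hnorm_ge0 // exprMn.
have [->|y0] := eqVneq y 0.
  rewrite linear0r /= expr0n /= addr0 sqrtr0 expr0n /=.
  by rewrite mulr_ge0 ?sqr_ge0.
have ny : 0 < hnorm y ^+ 2.
  by rewrite -ltcR -inner_self neq0_dnorm_gt0.
set n := hnorm y ^+ 2 in ny *; set z := '<<x, y>>.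
have := dnorm_ge0 (inner H) (n%:C *: x - z *: y).
rewrite dnormB !dnormZ linearZr_LR /= linearZl_LR /= !inner_self -/n -/z.
rewrite !normc_def; case: z {n0} => a b; rewrite lecE /= => /andP[_].
rewrite expr0n /= addr0 sqrtr_sqr ger0_norm; last exact: ltW.
have r2 := sqr_sqrtr (addr_ge0 (sqr_ge0 a) (sqr_ge0 b)).
move=> h; rewrite -(ler_pM2l ny) r2; move: h r2; set r := Num.sqrt _ => h r2.
have r3 : r * r * n = (a ^+ 2 + b ^+ 2) * n by rewrite -expr2 r2.
lra.
Qed.

Lemma innerC x y : '<<y, x>> = ('<<x, y>>)^*.
Proof. by rewrite hermC /= expr0 mul1r. Qed.

Lemma hnormD x y : hnorm (x + y) <= hnorm x + hnorm y.
Proof.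
rewrite -(@ler_pXn2r _ 2) ?nnegrE ?addr_ge0 ?hnorm_ge0 //.
rewrite -lecR -inner_self dnormD !inner_self sqrrD !rmorphD /=.
have := le_trans (ler_norm _) (le_trans (normc_Re '<<x, y>>) (inner_CS x y)).
case: '<<x, y>> => a b /= h; rewrite lecE /=; apply/andP; split; last lra.
by apply/eqP; lra.
Qed.

Lemma hnormZ (c : F[i]) x : hnorm (c *: x) = normc c * hnorm x.
Proof.
have c0 : 0 <= normc c by case: (c) => ? ?; exact: sqrtr_ge0.
apply/eqP; rewrite -(@eqrXn2 _ 2) ?mulr_ge0 ?hnorm_ge0 //; apply/eqP.
apply: complexI; rewrite -inner_self dnormZ inner_self exprMn.
have -> : `|c| ^+ 2 = (normc c ^+ 2)%:C by rewrite rmorphXn.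
by rewrite -rmorphM.
Qed.

Lemma hnorm_eq0 x : hnorm x = 0 -> x = 0.
Proof.
by move=> h; apply/eqP; rewrite -(dnorm_eq0 (inner H)) inner_self h expr0n.
Qed.

End HilbertFacts.

Section TracialOf.
Context {F : realType} (M : vonNeumannAlg F) (tr : faithful_normal_trace M).
Local Notation H := (vn_space M).
Local Notation "'<< x , y >>" := (inner H x y).
Implicit Types (a b : M) (x y : H).

Definition vn_norm_bounds a : set F :=
  [set c | 0 <= c /\ forall x, hnorm (vn_act a x) <= c * hnorm x].

Definition vn_norm a : F := inf (vn_norm_bounds a).

Lemma vn_norm_has_inf a : has_inf (vn_norm_bounds a).
Proof.
split; last by exists 0 => c [].
have [_ [c ac]] := vn_act_bounded a; exists `|c|; split=> // x.
by rewrite (le_trans (ac x)) // ler_wpM2r ?hnorm_ge0 ?ler_norm.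
Qed.

Lemma vn_norm_ge0 a : 0 <= vn_norm a.
Proof. by apply: lb_le_inf; [case: (vn_norm_has_inf a)|move=> c []]. Qed.

Lemma vn_normP a x : hnorm (vn_act a x) <= vn_norm a * hnorm x.
Proof.
rewrite mulrC; apply: ler_gt_mul => [|c ac]; first exact: hnorm_ge0.
have [d [_ ad] dc] := inf_lt (vn_norm_has_inf a).1 ac.
by rewrite mulrC (le_trans (ad x)) // ler_wpM2r ?hnorm_ge0 // ltW.
Qed.

Lemma vn_norm_le a (c : F) : 0 <= c ->
  (forall x, hnorm (vn_act a x) <= c * hnorm x) -> vn_norm a <= c.
Proof. by move=> c0 ac; apply: ge_inf => //; case: (vn_norm_has_inf a). Qed.

Lemma vn_actD a b x : vn_act (a + b) x = vn_act a x + vn_act b x.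
Proof. by have := vn_act_linear x 1 a b; rewrite !scale1r. Qed.

Lemma vn_act0 x : vn_act (0 : M) x = 0.
Proof. by apply: (addrI (vn_act 0 x)); rewrite -vn_actD !addr0. Qed.

Lemma vn_actZ (c : F[i]) a x : vn_act (c *: a) x = c *: vn_act a x.
Proof. by have := vn_act_linear x c a 0; rewrite vn_act0 !addr0. Qed.

Lemma vn_actB a b x : vn_act (a - b) x = vn_act a x - vn_act b x.
Proof. by rewrite vn_actD -(scaleN1r b) vn_actZ scaleN1r. Qed.

Lemma vn_normD a b : vn_norm (a + b) <= vn_norm a + vn_norm b.
Proof.
apply: vn_norm_le => [|x]; first by rewrite addr_ge0 ?vn_norm_ge0.
by rewrite vn_actD mulrDl (le_trans (hnormD _ _)) // lerD // vn_normP.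
Qed.

Lemma vn_normZ (c : F[i]) a : vn_norm (c *: a) <= normc c * vn_norm a.
Proof.
have c0 : 0 <= normc c by case: (c) => ? ?; exact: sqrtr_ge0.
apply: vn_norm_le => [|x]; first by rewrite mulr_ge0 ?vn_norm_ge0.
by rewrite vn_actZ hnormZ -mulrA ler_wpM2l // vn_normP.
Qed.

Lemma vn_normM a b : vn_norm (a * b) <= vn_norm a * vn_norm b.
Proof.
apply: vn_norm_le => [|x]; first by rewrite mulr_ge0 ?vn_norm_ge0.
rewrite vn_actM /= (le_trans (vn_normP _ _)) // -mulrA.
by rewrite ler_wpM2l ?vn_norm_ge0 // vn_normP.
Qed.

Lemma vn_norm_star a : vn_norm (star a) = vn_norm a.
Proof.
suff h b : vn_norm (star b) <= vn_norm b.
  by apply/le_anti; rewrite h /= -{1}(starK a) h.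
apply: vn_norm_le => [|x]; first exact: vn_norm_ge0.
set z := vn_act (star b) x.
have zz : '<<z, z>> = '<<x, vn_act b z>> by rewrite {1}/z vn_act_star starK.
have [->|z0] := eqVneq (hnorm z) 0; first by rewrite mulr_ge0 ?vn_norm_ge0 ?hnorm_ge0.
have zp : 0 < hnorm z by rewrite lt_def z0 hnorm_ge0.
rewrite -(ler_pM2l zp) -expr2.
have -> : hnorm z ^+ 2 = complex.Re '<<x, vn_act b z>> by rewrite -zz inner_self.
apply: le_trans (ler_norm _) _; apply: le_trans (normc_Re _) _.
apply: le_trans (inner_CS _ _) _; rewrite mulrC mulrA ler_wpM2r ?hnorm_ge0 //.
by rewrite mulrC vn_normP.
Qed.

Lemma inner_starmul a x :
  '<<vn_act (star a * a) x, x>> = (hnorm (vn_act a x) ^+ 2)%:C.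
Proof. by rewrite vn_actM /= vn_act_star starK inner_self. Qed.

Lemma vn_pos_star a : vn_pos (star a * a).
Proof. by move=> x; rewrite inner_starmul ler0c sqr_ge0. Qed.

Lemma tr_ge0 a : 0 <= tr (star a * a).
Proof. exact: fnt_pos (vn_pos_star a). Qed.

Lemma trM_le a b : tr (star (a * b) * (a * b))
  <= (vn_norm a ^+ 2)%:C * tr (star b * b).
Proof.
have e : tr ((vn_norm a ^+ 2)%:C *: (star b * b) + -1 *: (star (a * b) * (a * b)))
   = (vn_norm a ^+ 2)%:C * tr (star b * b) - tr (star (a * b) * (a * b)).
  have t0 : tr 0 = 0.
    by have := fnt_linear tr 1 0 0; rewrite scaler0 addr0 mul1r => h; apply: (addrI (tr 0)); rewrite addr0 -h.
  have tZ c d : tr (c *: d) = c * tr d.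
    by have := fnt_linear tr c d 0; rewrite addr0 t0 addr0.
  by rewrite (fnt_linear tr) tZ mulN1r.
rewrite -subr_ge0 -e; apply: fnt_pos => x; rewrite scaleN1r vn_actB vn_actZ.
rewrite linearBl linearZl_LR /= !inner_starmul vn_actM /=.
rewrite subr_ge0 -rmorphM /= lecR -exprMn.
by rewrite lerXn2r ?nnegrE ?mulr_ge0 ?hnorm_ge0 ?vn_norm_ge0 // vn_normP.
Qed.

Definition tracial_of : tracialAlg F :=
  @TracialAlg F M vn_norm tr vn_norm_ge0 vn_normD vn_normZ vn_normM vn_norm_star
    (fnt_linear tr) (fnt1 tr) (fntC tr) tr_ge0 (fnt_faithful (f := tr)) trM_le.

End TracialOf.

(* Isomorphism of tracial von Neumann algebras: a trace-preserving
   *-isomorphism. *)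
Definition tracial_iso (F : realType) (A B : tracialAlg F) :=
  exists f : A -> B,
    [/\ bijective f, linear f, {morph f : x y / x * y},
        {morph f : x / star x} & forall x, tau (f x) = tau x].

(* Main.v *)
Require Import Defs.
From mathcomp Require Import all_boot all_order all_algebra complex.
From mathcomp Require Import all_classical all_reals topology normedtype.

(** The isomorphism is currying.  Let U and V be ultrafilters on I and J.  A
    bounded family (x_ij) over I * J is the same thing as a family, indexed by
    i, of uniformly bounded families j |-> x_ij, and so it defines the element
    [i |-> [j |-> x_ij]_V]_U of the iterated ultrapower (A^V)^U.

    The trace of that element is the limit along U of the limit along V of
    tau (x_ij), which is the limit along the tensor product
    ([cvg_tensor_iter], the Fubini property of limits along ultrafilters);
    hence currying of families preserves traces ([utau_curry]).  Since currying
    is a *-homomorphism and the traces are faithful, preservation of the trace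
    gives at once that the map is well defined on classes and injective: a
    family and its curried version are null together ([upi_curry_eq]).

    Surjectivity is where uniform boundedness matters.  In an element
    [i |-> u_i]_U of (A^V)^U the u_i are uniformly bounded in the quotient
    norm of A^V, which is an infimum over representatives; so the u_i have
    representatives that are bounded by one constant, and these fit together
    into one bounded family over I * J ([curry_surj]). *)

Set Implicit Arguments.
Unset Strict Implicit.
Unset Printing Implicit Defensive.

Import Order.TTheory GRing.Theory Num.Theory.
Import numFieldNormedType.Exports.

Local Open Scope classical_set_scope.
Local Open Scope ring_scope.

Lemma tau_star_mul_eq0 (F : realType) (A : tracialAlg F) (x : A) :
  x = 0 <-> tau (star x * x) = 0.
Proof. by split=> [->|/tau_eq0//]; rewrite mulr0 linear0. Qed.

(** The inverse of a bijective trace-preserving *-homomorphism is one, which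
    allows an isomorphism to be built in the more convenient direction. *)
Lemma tracial_iso_sym (F : realType) (A B : tracialAlg F) :
  tracial_iso A B -> tracial_iso B A.
Proof.
move=> [f [[g fK gK] fL fM fS ft]]; exists g; split.
- by exists f.
- by move=> a x y; apply: (can_inj fK); rewrite fL !gK.
- by move=> x y; apply: (can_inj fK); rewrite fM !gK.
- by move=> x; apply: (can_inj fK); rewrite fS !gK.
- by move=> x; rewrite -[in RHS](gK x) ft.
Qed.

Section IteratedUltrapower.
Context {F : realType} {I J : Type} (A : tracialAlg F).
Context (U : ultrafilter I) (V : ultrafilter J).
Local Notation UV := (tensor U V).
Local Notation B := (ultrapower A V).
Implicit Types x y : linf (I * J) A.

(** If g is e-close to l for UV-almost all (i, j), then for U-almost all i
    this holds for V-almost all j, and then the V-limit h i is within e of l: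
    closed balls contain their limits. *)
Lemma cvg_tensor_iter (g : I * J -> F) (h : I -> F) (l : F) :
  g @ UV --> l -> (forall i, (fun j => g (i, j)) @ V --> h i) -> h @ U --> l.
Proof.
move=> gl gh; apply/cvgrPdist_le => e e0.
have /cvgrPdist_le/(_ e e0) := gl.
apply: (@filterS _ U) => i /= gi.
have dh : (fun j => `|l - g (i, j)|) @ V --> `|l - h i|.
  by apply: cvg_norm; apply: cvgB; [exact: cvg_cst|exact: gh].
rewrite -(ultra_lim dh); apply: limr_le => //.
by apply/cvg_ex; eexists; exact: dh.
Qed.

Lemma clim_tensor_iter (z : I * J -> F[i]) (c : F) :
  (forall k, normc (z k) <= c) ->
  clim U (fun i => clim V (fun j => z (i, j))) = clim UV z.
Proof.
move=> zc; have [zR zI] := climP UV zc.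
have zV i := @climP _ _ V (fun j => z (i, j)) c (fun j => zc (i, j)).
by apply: clim_eq; [apply: cvg_tensor_iter zR _ => i; have [] := zV i
                   |apply: cvg_tensor_iter zI _ => i; have [] := zV i].
Qed.

Fact linf_section_bounded x i : (fun j => x (i, j)) \in @is_bounded F J A.
Proof.
by have [c _ xc] := linfP x; apply/is_boundedP; exists c => j; exact: xc.
Qed.

Definition linf_section x i : linf J A := Linf (linf_section_bounded x i).

Fact curry_bounded x :
  (fun i => upi V (linf_section x i) : B) \in @is_bounded F I B.
Proof.
have [c _ xc] := linfP x; apply/is_boundedP; exists c => i.
by apply: unorm_le => j; exact: xc.
Qed.

Definition curry x : linf I B := Linf (curry_bounded x).

Lemma curryP a x y : curry (a *: x + y) = a *: curry x + curry y.
Proof.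
apply/val_inj/funext => i.
rewrite -[RHS]/(a *: upi V (linf_section x i) + upi V (linf_section y i)).
by rewrite -upiZ' -upiD; congr upi; apply/val_inj/funext.
Qed.

Lemma curryB x y : curry (x - y) = curry x - curry y.
Proof. by rewrite addrC -scaleN1r curryP scaleN1r addrC. Qed.

Lemma curryM x y : curry (x * y) = curry x * curry y.
Proof.
apply/val_inj/funext => i.
rewrite -[RHS]/(upi V (linf_section x i) * upi V (linf_section y i)).
by rewrite -upiM'; congr upi; apply/val_inj/funext.
Qed.

Lemma curry_star x : curry (linf_star x) = linf_star (curry x).
Proof.
apply/val_inj/funext => i.
rewrite -[RHS]/(ustar (upi V (linf_section x i))).
by rewrite -upi_star; congr upi; apply/val_inj/funext.
Qed.

Lemma utau_curry x : utau (upi U (curry x)) = utau (upi UV x).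
Proof.
have [c _ xc] := linfP x.
rewrite !utauE -(@clim_tensor_iter _ c) => [|k]; last first.
  exact: le_trans (normc_tau _) (xc k).
by congr (clim U _); apply/funext => i; exact: utauE.
Qed.

Lemma upi_curry_eq0 x : upi U (curry x) = 0 <-> upi UV x = 0.
Proof.
have e : utau (ustar (upi U (curry x)) * upi U (curry x))
       = utau (ustar (upi UV x) * upi UV x).
  by rewrite -!upi_star -!upiM' -curry_star -curryM utau_curry.
apply: iff_trans (@tau_star_mul_eq0 _ (ultrapower B U) _) _.
apply: iff_trans _ (iff_sym (@tau_star_mul_eq0 _ (ultrapower A UV) _)).
by rewrite /= e.
Qed.

Lemma upi_curry_eq x y :
  upi U (curry x) = upi U (curry y) <-> upi UV x = upi UV y.
Proof.
have eB (K : Type) (C : tracialAlg F) (W : ultrafilter K) (z w : linf K C) :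
    upi W z = upi W w <-> upi W (z - w) = 0.
  by rewrite upiD upiN; split=> [->|/subr0_eq//]; rewrite subrr.
apply: iff_trans (eB _ _ _ _ _) _; rewrite -curryB.
exact: iff_trans (upi_curry_eq0 _) (iff_sym (eB _ _ _ _ _)).
Qed.

Lemma curry_surj (z : linf I B) : exists x, curry x = z.
Proof.
have [c _ zc] := linfP z.
(* The quotient norm need not be attained by a representative, hence the
   slack of 1 in the common bound. *)
have lift i : exists y : linf J A,
    upi V y = z i /\ forall j, opnorm (y j) <= c + 1.
  by apply: unorm_lt; apply: le_lt_trans (zc i) _; rewrite ltrDl.
have [y yz] := choice lift.
have xb : (fun k : I * J => y k.1 k.2) \in @is_bounded F _ A.
  by apply/is_boundedP; exists (c + 1) => -[i j]; have [_] := yz i; exact.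
exists (Linf xb); apply/val_inj/funext => i /=.
have [<- _] := yz i; congr upi; exact/val_inj/funext.
Qed.

Definition ucurry (u : ultrapower A UV) : ultrapower B U :=
  upi U (curry (urepr u)).

Lemma ucurryE x : ucurry (upi UV x) = upi U (curry x).
Proof. by apply/upi_curry_eq; exact: ureprK. Qed.

Lemma ucurry_bij : bijective ucurry.
Proof.
have inj : injective ucurry.
  by move=> u v /upi_curry_eq; rewrite !ureprK.
have surj w : exists u, ucurry u = w.
  have [x xw] := curry_surj (urepr w).
  by exists (upi UV x); rewrite ucurryE xw; exact: ureprK.
have [g gK] := choice surj.
by exists g => // u; apply: inj; rewrite gK.
Qed.

Theorem ultrapower_iterated :
  tracial_iso (ultrapower (ultrapower A V) U) (ultrapower A (tensor U V)).
Proof.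
apply: tracial_iso_sym; exists ucurry; split; first exact: ucurry_bij.
- move=> a; elim/(@upi_ind F _ A UV) => x; elim/(@upi_ind F _ A UV) => y.
  by rewrite -upiZ' -upiD !ucurryE curryP upiD upiZ'.
- elim/(@upi_ind F _ A UV) => x; elim/(@upi_ind F _ A UV) => y.
  by rewrite -upiM' !ucurryE curryM upiM'.
- elim/(@upi_ind F _ A UV) => x.
  by rewrite /= -upi_star !ucurryE curry_star upi_star.
- by elim/(@upi_ind F _ A UV) => x; rewrite ucurryE; exact: utau_curry.
Qed.

End IteratedUltrapower.

Theorem proposition2p1 (F : realType)
    (R : vonNeumannAlg F) (tr : faithful_normal_trace R)
    (omega omega' : ultrafilter nat) :
  hyperfinite_II1_factor R ->
  free_ultrafilter omega -> free_ultrafilter omega' ->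
  tracial_iso
    (ultrapower (ultrapower (tracial_of tr) omega) omega')
    (ultrapower (tracial_of tr) (tensor omega' omega)).
Proof. by move=> _ _ _; exact: ultrapower_iterated. Qed.
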